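(* Let $\mathbb{F}_q$ be a finite field of characteristic $p$, let $U\le\mathbb{F}_q$ be an $\mathbb{F}_p$-linear subspace, let $a\in\mathbb{F}_q$, and let $\mathcal{A}=a+U\subseteq\mathbb{F}_q$ be an affine translation of size $r$. Assume that $s=p^ut$ with $u\ge0$, $1\le t\le p-1$, and that $rs$ is even. Choose $\lambda\in\mathbb{F}_q^\ast$. If $s$ is odd, assume in addition that $\lambda$ is a square in $\mathbb{F}_q$. Let $V=(v_{i,\alpha})\in(\mathbb{F}_q^\ast)^{s\times r}$ be a multiplier matrix, with columns indexed by the evaluation points $\alpha\in\mathcal{A}$, such that \[ v_{i,\alpha}v_{s-i+1,\alpha}=\lambda,\qquad 1\le i\le s,\quad\alpha\in\mathcal{A}. \] Then the HRS code $C=\operatorname{HRS}_{\frac{rs}{2}}(\mathcal{A},V,s,r)$ is reverse self-dual.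
   Context: For an integer $h\ge 0$, $\mathcal{P}_{<h}=\{f\in\mathbb{F}_q[x]:\deg f<h\}$. Hasse derivative: for $f(x)=\sum_\ell f_\ell x^\ell\in\mathbb{F}_q[x]$ and $j\ge0$, $\partial^{(j)}f(x)=\sum_{\ell}\binom{\ell}{j}f_\ell x^{\ell-j}$ (with $\binom{\ell}{j}=0$ if $j>\ell$, binomials reduced modulo the characteristic). Hyperderivative Reed–Solomon (HRS) code: for a set $\mathcal{A}=\{\alpha_1,\ldots,\alpha_r\}$ of $r$ distinct elements of $\mathbb{F}_q$, $V=(v_{i,j})\in(\mathbb{F}_q^\ast)^{s\times r}$ (one may index columns by the points $\alpha\in\mathcal{A}$ themselves) and $0\le k\le rs$, \[ \operatorname{HRS}_k(\mathcal{A},V,s,r)=\left\{\bigl(v_{i,j}\,\partial^{(i-1)}f(\alpha_j)\bigr)_{1\le i\le s,\,1\le j\le r}: f\in\mathcal{P}_{<k}\right\}\subseteq\operatorname{Mat}_{s\times r}(\mathbb{F}_q). \] Reverse bilinear form on $\operatorname{Mat}_{s\times r}(\mathbb{F}_q)$: $[A,B]_{\rm rev}=\sum_{j=1}^r\sum_{i=1}^s a_{i,j}b_{s-i+1,j}$. The reverse dual of a linear code $C$ is $C^{\perp_{\rm rev}}=\{B:[A,B]_{\rm rev}=0\text{ for all }A\in C\}$, and $C$ is reverse self-dual if $C=C^{\perp_{\rm rev}}$. *)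

(* Defs.v *)
From HB Require Import structures.
From mathcomp Require Import all_boot all_fingroup all_algebra all_field.

Set Implicit Arguments.
Unset Strict Implicit.
Unset Printing Implicit Defensive.

Import GRing.Theory.
Local Open Scope ring_scope.

(* Rows are numbered from 0: row i : 'I_s carries the Hasse derivative of      *)
(* order i, and the row s - i + 1 of 1-based numbering becomes rev_ord i.      *)
(* The evaluation points are listed as alpha_0, ..., alpha_(r-1); alpha is     *)
(* meant to be injective.  f^`N(i), the library's i-th derivative divided by   *)
(* i!, is defined with binomial coefficients (see coef_nderivn), hence is the  *)
(* Hasse derivative in every characteristic.                                   *)
Definition hrs_word (F : nzRingType) (s r : nat) (alpha : 'I_r -> F)
    (V : 'M[F]_(s, r)) (f : {poly F}) : 'M[F]_(s, r) :=
  \matrix_(i < s, j < r) (V i j * (f^`N(i)).[alpha j]).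

(* {poly_k F} is the type of polynomials of size at most k, that is, of degree *)
(* less than k.                                                                *)
Definition hrs_code (F : finFieldType) (s r k : nat) (alpha : 'I_r -> F)
    (V : 'M[F]_(s, r)) : {set 'M[F]_(s, r)} :=
  [set hrs_word alpha V (f : {poly F}) | f : {poly_k F}].

Definition rev_form (F : nzRingType) (s r : nat) (A B : 'M[F]_(s, r)) : F :=
  \sum_(j < r) \sum_(i < s) A i j * B (rev_ord i) j.

Definition rev_dual (F : finFieldType) (s r : nat)
    (C : {set 'M[F]_(s, r)}) : {set 'M[F]_(s, r)} :=
  [set B | [forall A in C, rev_form A B == 0]].

Definition rev_self_dual (F : finFieldType) (s r : nat)
    (C : {set 'M[F]_(s, r)}) : Prop :=
  C = rev_dual C.

(* Main.v *)
Require Import Defs.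
From mathcomp Require Import all_boot all_fingroup all_algebra all_field.
Import GRing.Theory.
Set Implicit Arguments.
Unset Strict Implicit.
Unset Printing Implicit Defensive.

Local Open Scope ring_scope.

(** The polynomial Q = prod_(0 != u in U) (X - u) is invariant under X -> z X
    for z in the prime field, z != 0, so Q = Q(0) mod X^(p-1); raising to the
    power s = p^u t with t <= p-1 gives Q^s = c mod X^s, where c = Q(0)^s.
    Hence, up to the factor c, the polynomials
      prod_(k != j) (X - alpha_k)^s (X - alpha_j)^i      (i < s)
    form the Hermite interpolation basis of the polynomials of degree < rs.
    Comparing coefficients of X^(rs-1) yields
      sum_j D^(s-1) h (alpha_j) = c h_(rs-1)             (deg h < rs),
    and by the Leibniz rule the reverse form of the words of f and g is
    lambda c (f g)_(rs-1).  It vanishes when f and g have degree < rs/2.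
    Conversely every matrix is the word of some g of degree < rs, and if
    deg g >= rs/2 then f = X^(rs-1-deg g) shows that it is not in the dual. *)

(** * Hasse derivatives as Taylor coefficients *)

Lemma coef_comp_XaddC (R : comNzRingType) (f : {poly R}) (a : R) (i : nat) :
  (f \Po ('X + a%:P))`_i = f^`N(i).[a].
Proof.
have cXa : GRing.comm a%:P ('X : {poly R}) by exact: mulrC.
rewrite /comp_poly addrC (nderiv_taylor _ cXa).
have szf : (size (map_poly polyC f) <= size f)%N by exact: size_poly.
under eq_bigr => k _ do rewrite nderivn_map horner_map.
rewrite coef_sum; under eq_bigr => k _ do rewrite coefCM coefXn.
have [ltif | leif] := ltnP i (size (map_poly polyC f)).
  rewrite (bigD1 (Ordinal ltif)) //= eqxx mulr1 big1 ?addr0 // => k /negPf nk.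
  by rewrite -[i]/(val (Ordinal ltif)) eq_sym [_ == _]nk mulr0.
rewrite big1 => [|k _]; last first.
  by rewrite gtn_eqF ?mulr0 // (leq_trans (ltn_ord k)).
rewrite nderivn_poly0 ?horner0 //; move: leif.
by rewrite size_map_inj_poly //; exact: polyC_inj.
Qed.

(** Leibniz rule: Taylor expansion at [a] is multiplicative, and coefficients of a product
    convolve. *)
Lemma horner_nderivnM (R : comNzRingType) (f g : {poly R}) (n : nat) (a : R) :
  (f * g)^`N(n).[a] = \sum_(i < n.+1) f^`N(i).[a] * g^`N(n - i).[a].
Proof.
rewrite -coef_comp_XaddC comp_polyM coefM.
by apply: eq_bigr => i _; rewrite !coef_comp_XaddC.
Qed.

Lemma dvdp_XnP (F : fieldType) (f : {poly F}) (n : nat) :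
  reflect (forall i, (i < n)%N -> f`_i = 0) ('X^n %| f).
Proof.
apply: (iffP idP) => [/dvdpP[g ->] i ltin | f0].
  by rewrite coefMXn ltin.
apply/dvdpP; exists (drop_poly n f); apply/polyP => i.
by rewrite coefMXn coef_drop_poly; case: ltnP => [/f0 | /subnK ->].
Qed.

(** The substitution X -> X + a is invertible and turns (X - a)^n into X^n. *)
Lemma dvdp_XsubC_expP (F : fieldType) (f : {poly F}) (a : F) (n : nat) :
  reflect (forall i, (i < n)%N -> f^`N(i).[a] = 0) (('X - a%:P) ^+ n %| f).
Proof.
have E : (('X - a%:P) ^+ n %| f) = ('X^n %| f \Po ('X + a%:P)).
  apply/idP/idP => [/(dvdp_comp_poly ('X + a%:P)) |
    /(dvdp_comp_poly ('X - a%:P))].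
    by rewrite rmorphXn /= comp_polyB comp_polyX comp_polyC addrK.
  by rewrite comp_polyXaddC_K rmorphXn /= comp_polyX.
rewrite E; by apply: (iffP (dvdp_XnP _ _)) => f0 i /f0; rewrite coef_comp_XaddC.
Qed.

(** The factors (X - alpha_j)^s are pairwise coprime and each divides [f], so a nonzero [f] would
    have degree at least rs. *)
Lemma nderivn_inj (F : fieldType) (r s : nat) (alpha : 'I_r -> F) (f : {poly F}) :
  injective alpha -> (size f <= r * s)%N ->
  (forall i j, (i < s)%N -> f^`N(i).[alpha j] = 0) -> f = 0.
Proof.
move=> alpha_inj szf f0; apply/eqP; apply: contraTT szf => nzf; rewrite -ltnNge.
have dvd_prod (t : seq 'I_r) : uniq t ->
    \prod_(j <- t) ('X - (alpha j)%:P) ^+ s %| f.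
  elim: t => [|j t IHt] /=; first by rewrite big_nil dvd1p.
  case/andP=> jt /IHt {}IHt; rewrite big_cons Gauss_dvdp.
    by rewrite IHt andbT; apply/dvdp_XsubC_expP => i /f0.
  rewrite big_seq; apply: (big_rec (coprimep _)) => [|k P kt cP].
    by rewrite coprimep1.
  rewrite coprimepMr cP andbT coprimep_expl // coprimep_expr //.
  rewrite coprimep_XsubC2 // subr_eq0 inj_eq //.
  by apply: contraNneq jt => <-.
have /(dvdp_leq nzf) := dvd_prod _ (index_enum_uniq _).
apply: leq_trans; rewrite -[in leqRHS](@prednK (size _)) ?ltnS; last first.
  rewrite size_poly_gt0 monic_neq0 // rpred_prod // => j _.
  by rewrite rpredX ?monicXsubC.
rewrite prodrXl size_exp size_prod_XsubC /=.
by rewrite -[index_enum _]enumT size_enum_ord leqnn.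
Qed.

(** * The product of X - w over the nonzero w of a set stable under scaling *)

Lemma coef_comp_scaleX (R : comNzRingType) (f : {poly R}) (z : R) (i : nat) :
  (f \Po (z *: 'X))`_i = z ^+ i * f`_i.
Proof.
rewrite coef_comp_poly; under eq_bigr => k _ do rewrite exprZn coefZ coefXn.
have [ltif | leif] := ltnP i (size f).
  rewrite (bigD1 (Ordinal ltif)) //= eqxx mulr1 big1 ?addr0 1?mulrC // => k nk.
  have /negPf-> : i != k by apply: contraNneq nk => ik; apply/eqP/val_inj.
  by rewrite !mulr0.
rewrite big1 => [|k _]; first by rewrite nth_default ?mulr0.
by rewrite gtn_eqF ?mulr0 // (leq_trans (ltn_ord k)).
Qed.

Lemma coef0_prod_XsubC_neq0 (F : finFieldType) (W : {set F}) :
  (\prod_(w in W :\ 0) ('X - w%:P))`_0 != 0.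
Proof.
rewrite -horner_coef0 horner_prod; apply/prodf_neq0 => w /setD1P[nz_w _].
by rewrite !hornerE oppr_eq0.
Qed.

(** Multiplication by [z] permutes the nonzero elements of [W], so Q(zX) = z^d Q(X) with d their
    number. The constant coefficient is nonzero, which forces z^d = 1. *)
Lemma coef_prod_XsubC_scale (F : finFieldType) (W : {set F}) (z : F) :
  z != 0 -> (forall w, w \in W -> z * w \in W) ->
  let Q := \prod_(w in W :\ 0) ('X - w%:P) in
  forall i, z ^+ i * Q`_i = Q`_i.
Proof.
move=> nz_z Wz Q.
have zW : [set z * w | w in W :\ 0] = W :\ 0.
  apply/eqP; rewrite eqEcard card_imset ?leqnn ?andbT; last exact: mulfI.
  apply/subsetP => _ /imsetP[w /setD1P[nz_w Ww] ->].
  by rewrite !inE mulf_neq0 ?Wz.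
have QE : Q \Po (z *: 'X) = z ^+ #|W :\ 0| *: Q.
  rewrite rmorph_prod /= -[in LHS]zW big_imset /=; last first.
    by move=> x y _ _; exact: mulfI.
  rewrite -[RHS]mul_polyC polyC_exp -prodr_const -big_split /=.
  apply: eq_bigr => w _; rewrite comp_polyB comp_polyX comp_polyC.
  by rewrite mulrBr mul_polyC polyCM.
have QiE i : z ^+ i * Q`_i = z ^+ #|W :\ 0| * Q`_i.
  by rewrite -[RHS]coefZ -QE coef_comp_scaleX.
have nz_Q0 : Q`_0 != 0 by exact: coef0_prod_XsubC_neq0.
have zW1 : z ^+ #|W :\ 0| = 1.
  by apply: (mulIf nz_Q0); rewrite -QiE.
by move=> i; rewrite QiE zW1 mul1r.
Qed.

Lemma dvdp_prod_XsubC_stable (F : finFieldType) (p : nat) (W : {set F}) :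
  p \in [pchar F] -> (forall w n, w \in W -> w *+ n \in W) ->
  let Q := \prod_(w in W :\ 0) ('X - w%:P) in
  'X^(p.-1) %| Q - (Q`_0)%:P.
Proof.
move=> charFp WM /=; set Q := \prod_(w in _) _; apply/dvdp_XnP => -[_ | i ltip].
  by rewrite coefB coefC subrr.
rewrite coefB coefC subr0; apply/eqP; apply: contraLR ltip => nzQi.
(* Otherwise 1, ..., p-1 are p-1 distinct roots of 'X^(i.+1) - 1. *)
have nzn (n : 'I_p.-1) : (n.+1%:R : F) != 0.
  rewrite -(dvdn_pcharf charFp) gtnNdvd // -ltn_predRL.
  by exact: ltn_ord.
pose P : {poly F} := 'X^(i.+1) - 1.
have szP : size P = i.+2 by rewrite size_XnsubC.
rewrite -leqNgt -ltnS -szP -[p.-1]size_enum_ord.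
rewrite -(size_map (fun n : 'I__ => n.+1%:R : F)).
apply: max_poly_roots; first by rewrite -size_poly_gt0 szP.
  apply/allP => _ /mapP[n _ ->]; rewrite /root !hornerE subr_eq0.
  apply/eqP/(mulIf nzQi); rewrite mul1r; apply: coef_prod_XsubC_scale => // w Ww.
  by rewrite mulr_natl WM.
rewrite map_inj_uniq ?enum_uniq // => m n /eqP /= mn; apply/val_inj.
wlog lemn : m n mn / (m <= n)%N.
  move=> IH; case/orP: (leq_total m n) => ?; [|apply/esym];
  by apply: IH; rewrite // eq_sym.
(* Now [p] divides n - m, which is smaller than [p] and hence zero. *)
move: mn; rewrite eq_sym -subr_eq0 -natrB // -(dvdn_pcharf charFp) subSS.
case: (posnP (n - m)) => [/eqP | gt0].
  by rewrite subn_eq0 => lenm _; apply/eqP; rewrite eqn_leq lemn.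
rewrite gtnNdvd // (leq_ltn_trans (leq_subr _ _)) //.
by rewrite (leq_trans (ltn_ord n)) ?leq_pred.
Qed.

(** By Frobenius, Q^(p^u) - c^(p^u) = (Q - c)^(p^u), which X^(m p^u) divides. This difference
    divides that of the t-th powers, and t <= m. *)
Lemma dvdp_exp_subC (F : fieldType) (p u t m : nat) (Q : {poly F}) (c : F) :
  p \in [pchar F] -> (t <= m)%N -> 'X^m %| Q - c%:P ->
  'X^(p ^ u * t) %| Q ^+ (p ^ u * t) - (c ^+ (p ^ u * t))%:P.
Proof.
move=> charFp letm dvdQ.
have pu_nat : [pchar {poly F}].-nat (p ^ u)%N.
  rewrite (eq_pnat _ (pchar_poly F)) pnatX pnatE ?charFp //.
  exact: pcharf_prime charFp.
rewrite polyC_exp !exprM subrXX dvdp_mulr // -exprNn_pchar //.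
have -> : Q ^+ (p ^ u) + (- c%:P) ^+ (p ^ u) = (Q - c%:P) ^+ (p ^ u).
  by rewrite exprDn_pchar.
rewrite -exprM mulnC !exprM dvdp_exp2r //.
by rewrite (dvdp_trans _ dvdQ) // dvdp_exp2l.
Qed.

(** * Hermite interpolation with a constant cofactor *)

Definition hermite_basis (F : fieldType) (s r : nat) (alpha : 'I_r -> F)
    (i : nat) (j : 'I_r) : {poly F} :=
  (\prod_(k < r | k != j) ('X - (alpha k)%:P)) ^+ s * ('X - (alpha j)%:P) ^+ i.

Lemma monic_hermite_basis (F : fieldType) (s r : nat) (alpha : 'I_r -> F)
  (i : nat) (j : 'I_r) : hermite_basis s alpha i j \is monic.
Proof. by rewrite rpredM ?rpredX ?monicXsubC ?monic_prod_XsubC. Qed.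

Lemma size_hermite_basis (F : fieldType) (s r : nat) (alpha : 'I_r -> F)
  (i : nat) (j : 'I_r) : size (hermite_basis s alpha i j) = (r.-1 * s + i).+1.
Proof.
have szA : size (\prod_(k < r | k != j) ('X - (alpha k)%:P)) = r.
  rewrite size_prod => [|k _]; last by rewrite polyXsubC_eq0.
  under eq_bigr => k _ do rewrite size_XsubC.
  rewrite sum_nat_const cardC1 card_ord muln2 -addnn -addSn addnK prednK //.
  exact: leq_trans (ltn_ord j).
rewrite size_monicM ?rpredX ?monic_prod_XsubC ?expf_neq0 ?polyXsubC_eq0 //.
have := size_exp (\prod_(k < r | k != j) ('X - (alpha k)%:P)) s.
have := size_exp ('X - (alpha j)%:P) i.
rewrite szA size_XsubC mul1n.
case: (size _) (size_exp_XsubC i (alpha j)) => // ? [->] _.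
have : (0 < size ((\prod_(k < r | k != j) ('X - (alpha k)%:P)) ^+ s))%N.
  by rewrite size_poly_gt0 monic_neq0 ?rpredX ?monic_prod_XsubC.
by case: (size _) => //= n _ ->; rewrite addnS.
Qed.

(** The basis polynomial is monic of degree (r-1)(s+1) + i, which reaches r(s+1) - 1 only for i =
    s. *)
Lemma coef_hermite_basis (F : fieldType) (s r : nat) (alpha : 'I_r -> F)
    (i : 'I_s.+1) (j : 'I_r) :
  (hermite_basis s.+1 alpha i j)`_(r * s.+1).-1 = (i == ord_max)%:R.
Proof.
have r_gt0 : (0 < r)%N by exact: leq_trans (ltn_ord j).
have E : (r * s.+1).-1 = (r.-1 * s.+1 + s)%N 
  by rewrite -{1}(prednK r_gt0) mulSn addSn addnC.
rewrite E; have [-> | ne_i] := eqVneq i ord_max.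
  have /monicP <- := monic_hermite_basis s.+1 alpha (@ord_max s) j.
  by rewrite /lead_coef size_hermite_basis.
rewrite nth_default // size_hermite_basis -addnS leq_add2l.
rewrite ltn_neqAle -ltnS ltn_ord andbT.
by apply: contraNneq ne_i => ?; apply/eqP/val_inj.
Qed.

(** At another point the factor (X - alpha_k)^s kills all derivatives of order below s. At alpha_j,
    translation leaves X^i times a cofactor congruent to c modulo X^s; in general this cofactor
    would have to be inverted modulo X^s, here it acts as a constant. *)
Lemma nderivn_hermite_basis (F : fieldType) (s r : nat) (alpha : 'I_r -> F)
    (c : F) (i m : nat) (j k : 'I_r) :
  'X^s %| (\prod_(l < r | l != j) ('X - (alpha l - alpha j)%:P)) ^+ s - c%:P ->
  (m < s)%N ->
  (hermite_basis s alpha i j)^`N(m).[alpha k] = ((k == j) && (m == i))%:R * c.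
Proof.
move=> dvdA lems; have [-> | ne_kj] /= := eqVneq k j; last first.
  rewrite mul0r; move: m lems; apply/dvdp_XsubC_expP.
  rewrite /hermite_basis (bigD1 k) //= exprMn -mulrA dvdp_mulr //.
rewrite -coef_comp_XaddC comp_polyM !rmorphXn /= rmorph_prod /=.
rewrite comp_polyB comp_polyX comp_polyC addrK.
under eq_bigr => l _ do
  rewrite comp_polyB comp_polyX comp_polyC -addrA -opprB -polyCB.
rewrite coefMXn; case: ltngtP => [ltmi | ltim | ->]; rewrite ?mul0r //.
  move/dvdp_XnP: dvdA => /(_ (m - i)%N (leq_ltn_trans (leq_subr _ _) lems)).
  by rewrite coefB coefC gtn_eqF ?subn_gt0 // subr0.
rewrite subnn mul1r; move/dvdp_XnP: dvdA => /(_ 0 (leq_ltn_trans _ lems)).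
by rewrite coefB coefC => /(_ isT)/eqP; rewrite subr_eq0 => /eqP.
Qed.

Lemma hermite_interpolation (F : fieldType) (s r : nat) (alpha : 'I_r -> F)
    (c : F) (B : 'M[F]_(s, r)) :
  c != 0 ->
  (forall j, 'X^s %|
    (\prod_(l < r | l != j) ('X - (alpha l - alpha j)%:P)) ^+ s - c%:P) ->
  let f := \sum_(j < r) \sum_(i < s) (B i j / c) *: hermite_basis s alpha i j in
  (size f <= r * s)%N /\ forall (i : 'I_s) j, f^`N(i).[alpha j] = B i j.
Proof.
move=> nz_c dvdA f; split.
  apply: (leq_trans (size_sum _ _ _)); apply/bigmax_leqP => j _.
  apply: (leq_trans (size_sum _ _ _)); apply/bigmax_leqP => i _.
  apply: (leq_trans (size_scale_leq _ _)); rewrite size_hermite_basis.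
  case: r alpha B j {dvdA f} => [|r] alpha B j; first by case: j.
  by rewrite /= mulSn addnC -addSn leq_add2r.
move=> i j; rewrite linear_sum /= horner_sum (bigD1 j) //=.
rewrite [X in _ + X]big1 => [|k ne_kj].
  rewrite addr0 linear_sum /= horner_sum (bigD1 i) //= big1 => [|l ne_li].
    rewrite addr0 linearZ hornerZ (nderivn_hermite_basis _ _ (dvdA _)) //.
    by rewrite !eqxx mul1r divfK.
  rewrite linearZ hornerZ (nderivn_hermite_basis _ _ (dvdA _)) // eqxx /=.
  have /negPf-> : i != l :> nat.
    by apply: contraNneq ne_li => ?; apply/eqP/val_inj.
  by rewrite mul0r mulr0.
rewrite linear_sum /= horner_sum big1 // => l _.
rewrite linearZ hornerZ (nderivn_hermite_basis _ _ (dvdA _)) //.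
by rewrite eq_sym (negPf ne_kj) mul0r mulr0.
Qed.

(** By uniqueness [f] is the Hermite interpolant of its own derivatives. In the coefficient of index
    r(s+1) - 1 only the basis polynomials with i = s survive, with weights D^s f(alpha_j) / c. *)
Lemma sum_nderivn (F : fieldType) (s r : nat) (alpha : 'I_r -> F)
    (c : F) (f : {poly F}) :
  injective alpha -> c != 0 ->
  (forall j, 'X^(s.+1) %|
    (\prod_(l < r | l != j) ('X - (alpha l - alpha j)%:P)) ^+ s.+1 - c%:P) ->
  (size f <= r * s.+1)%N ->
  \sum_(j < r) f^`N(s).[alpha j] = c * f`_(r * s.+1).-1.
Proof.
move=> alpha_inj nz_c dvdA szf.
pose B : 'M[F]_(s.+1, r) := \matrix_(i, j) f^`N(i).[alpha j].
have [] := hermite_interpolation B nz_c dvdA; set g := \sum_j _ => szg gB.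
have fg : f = g.
  apply/eqP; rewrite -subr_eq0; apply/eqP/(nderivn_inj (s := s.+1) alpha_inj) => //.
    by rewrite (leq_trans (size_polyD _ _)) // size_polyN geq_max szf.
  move=> i j ltis; rewrite nderivnB hornerD hornerN.
  by rewrite (gB (Ordinal ltis)) mxE subrr.
rewrite [in RHS]fg coef_sum mulr_sumr; apply: eq_bigr => j _.
rewrite coef_sum (bigD1 ord_max) // coefZ coef_hermite_basis eqxx mulr1.
rewrite big1 => [|i /= ne_i]; last first.
  by rewrite coefZ coef_hermite_basis (negPf ne_i) mulr0.
by rewrite /= addr0 [RHS]mulrC divfK // mxE.
Qed.

(** * The reverse form on code words and self-duality *)

Lemma rev_form_hrs_word (F : fieldType) (s r : nat) (alpha : 'I_r -> F)
    (V : 'M[F]_(s.+1, r)) (lambda : F) (f g : {poly F}) :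
  (forall i j, V i j * V (rev_ord i) j = lambda) ->
  rev_form (hrs_word alpha V f) (hrs_word alpha V g) =
    lambda * \sum_(j < r) (f * g)^`N(s).[alpha j].
Proof.
move=> V_rev; rewrite mulr_sumr; apply: eq_bigr => j _.
(* Row reversal pairs order i with order s - i, exactly the terms of the Leibniz rule. *)
rewrite horner_nderivnM mulr_sumr; apply: eq_bigr => i _.
by rewrite !mxE mulrACA V_rev.
Qed.

Lemma hrs_self_dual (F : finFieldType) (s r : nat) (alpha : 'I_r -> F)
    (c lambda : F) (V : 'M[F]_(s.+1, r)) :
  injective alpha -> c != 0 ->
  (forall j, 'X^(s.+1) %|
    (\prod_(l < r | l != j) ('X - (alpha l - alpha j)%:P)) ^+ s.+1 - c%:P) ->
  ~~ odd (r * s.+1) -> lambda != 0 ->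
  (forall i j, V i j != 0) ->
  (forall i j, V i j * V (rev_ord i) j = lambda) ->
  rev_self_dual (hrs_code (r * s.+1)./2 alpha V).
Proof.
move=> alpha_inj nz_c dvdA rs_even nz_lambda nzV V_rev.
have rsE : ((r * s.+1)./2 + (r * s.+1)./2)%N = (r * s.+1)%N.
  by rewrite addnn even_halfK.
(* The bound lets the product reach degree r(s+1) - 1, one more than two polynomials of the code can
   produce: the converse inclusion needs this coefficient to be nonzero. *)
have rev_formE (f g : {poly F}) : (size f + size g <= (r * s.+1).+1)%N ->
    rev_form (hrs_word alpha V f) (hrs_word alpha V g) =
    lambda * (c * (f * g)`_(r * s.+1).-1).
  move=> szfg; rewrite (rev_form_hrs_word _ _ _ V_rev).
  rewrite (sum_nderivn alpha_inj nz_c) //.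
  by rewrite (leq_trans (size_polyMleq _ _)) // -subn1 leq_subLR.
apply/eqP; rewrite eqEsubset; apply/andP; split; apply/subsetP => B.
  case/imsetP => g _ ->; rewrite inE; apply/forall_inP => _ /imsetP[f _ ->].
  have szfg : (size f + size g <= r * s.+1)%N.
    by rewrite -[leqRHS]rsE leq_add ?size_npoly.
  rewrite rev_formE ?leqW // nth_default ?mulr0 //.
  by rewrite (leq_trans (size_polyMleq _ _)) // -!subn1 leq_sub2r.
rewrite inE => /forall_inP dualB.
(* Interpolating [B] with the multipliers divided out makes [B] the word of some [g], still without
   the degree bound of the code. *)
have [] := hermite_interpolation (\matrix_(i, j) (B i j / V i j)) nz_c dvdA.
set g := \sum_j _ => szg gB.
have Bg : B = hrs_word alpha V g.
  by apply/matrixP => i j; rewrite mxE gB mxE mulrC divfK.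
suff szg2 : (size g <= (r * s.+1)./2)%N.
  by apply/imsetP; exists (npolyp _ g); rewrite // npolypK.
rewrite leqNgt; apply/negP => ltg.
(* As size g = deg g + 1, the monomial lifts the leading coefficient of [g] to index r(s+1) - 1. The
   strict bound [ltg] absorbs the extra one in the size of the monomial. *)
have szf : (size ('X^(r * s.+1 - size g) : {poly F}) <= (r * s.+1)./2)%N.
  by rewrite size_polyXn ltn_subLR // -[ltnLHS]rsE ltn_add2r.
have /dualB/eqP : hrs_word alpha V 'X^(r * s.+1 - size g)
    \in hrs_code (r * s.+1)./2 alpha V.
  by apply/imsetP; exists (npolyp _ 'X^(r * s.+1 - size g)); rewrite // npolypK.
rewrite Bg rev_formE; last by rewrite size_polyXn addSn subnK.
have g_gt0 : (0 < size g)%N by exact: leq_ltn_trans ltg.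
have [n szgE] : exists n, size g = n.+1 by exists (size g).-1; rewrite prednK.
have -> : (r * s.+1).-1 = ((size g).-1 + (r * s.+1 - size g))%N.
  by rewrite -[in LHS](subnKC szg) szgE.
rewrite coefXnM ltnNge leq_addl /= addnK => /eqP.
rewrite !mulf_eq0 (negPf nz_lambda) (negPf nz_c) /= -/(lead_coef g) lead_coef_eq0.
by rewrite -size_poly_eq0 gtn_eqF.
Qed.

(** * Affine translates of a subspace as evaluation sets *)

Theorem theorem19 (F : finFieldType) (p : nat) (charFp : p \in [pchar F])
    (U : {vspace pPrimeCharType charFp}) (a : F)
    (r : nat) (alpha : 'I_r -> F) (alpha_inj : injective alpha)
    (alphaA : [set alpha j | j : 'I_r] = [set a + (u : F) | u in U])
    (s u t : nat) (s_def : s = (p ^ u * t)%N) (t_ge1 : (1 <= t)%N)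
    (t_le : (t <= p - 1)%N) (rs_even : ~~ odd (r * s))
    (lambda : F) (lambda_neq0 : lambda != 0)
    (lambda_sq : odd s -> exists mu : F, lambda = mu ^+ 2)
    (V : 'M[F]_(s, r)) (V_neq0 : forall i j, V i j != 0)
    (V_rev : forall i j, V i j * V (rev_ord i) j = lambda) :
  rev_self_dual (hrs_code (r * s)./2 alpha V).
Proof.
have s_gt0 : (0 < s)%N.
  by rewrite s_def muln_gt0 expn_gt0 (prime_gt0 (pcharf_prime charFp)).
pose W : {set F} := [set w | (w : pPrimeCharType charFp) \in U].
have WM (w : F) n : w \in W -> w *+ n \in W by rewrite !inE; exact: rpredMn.
have alphaU j : exists2 w : F, w \in W & alpha j = a + w.
  have: alpha j \in [set alpha j | j : 'I_r] by exact: imset_f.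
  by rewrite alphaA => /imsetP[w Uw ->]; exists w; rewrite ?inE.
(* The translation [a] cancels in differences, so seen from any point the other points are the
   nonzero elements of the subspace. The cofactor, and with it [c], is thus the same for every j. *)
have diffs j : [set alpha k - alpha j | k : 'I_r & k != j] = W :\ 0.
  have [w0 Ww0 aj] := alphaU j.
  apply/setP => w; apply/imsetP/setD1P => [[k] | [nz_w Ww]].
    rewrite inE => ne_kj ->; split; first by rewrite subr_eq0 inj_eq.
    have [w1 Ww1 ->] := alphaU k; rewrite aj opprD addrACA subrr add0r.
    by move: Ww0 Ww1; rewrite !inE => Ww0 Ww1; exact: rpredB.
  have: a + (w0 + w) \in [set alpha j | j : 'I_r].
    rewrite alphaA; apply/imsetP; exists (w0 + w) => //.
    by move: Ww0 Ww; rewrite !inE; exact: rpredD.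
  case/imsetP => k _ ak; exists k; last by rewrite -ak aj addrA [RHS]addrC addKr.
  rewrite inE; apply: contraNneq nz_w => kj.
  by move: ak; rewrite kj aj addrA -[RHS]addr0 => /addrI->.
pose Q := \prod_(w in W :\ 0) ('X - w%:P).
have QE j : \prod_(k < r | k != j) ('X - (alpha k - alpha j)%:P) = Q.
  rewrite /Q -(diffs j) big_imset /=; first by apply: eq_bigl => k; rewrite inE.
  by move=> k l _ _ /addIr/alpha_inj.
have nz_Q0 : Q`_0 != 0 by exact: coef0_prod_XsubC_neq0.
(* The exponent [m] is p - 1 here, and [t_le] is the bound that Frobenius lifting requires. *)
have dvdQ : 'X^s %| Q ^+ s - (Q`_0 ^+ s)%:P.
  rewrite s_def; apply: (dvdp_exp_subC _ charFp t_le).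
  by rewrite subn1; exact: dvdp_prod_XsubC_stable.
case: s s_gt0 {s_def lambda_sq} V V_neq0 V_rev rs_even dvdQ => // s _.
move=> V V_neq0 V_rev rs_even dvdQ.
apply: hrs_self_dual (expf_neq0 s.+1 nz_Q0) _ rs_even _ V_neq0 V_rev => // j.
by rewrite QE.
Qed.
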